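(* Let $D$ be a positive integer and let $G$ be a graph with $\Delta(G)\le D$. If $G$ is nice with respect to some maximum clique $S$ of $G^2$, then $\omega(G^2)\le \frac52 D$.
   Context: The square $G^2$ of $G$ is obtained from $G$ by adding an edge between every pair of vertices at distance 2 in $G$. A $k$-degeneracy order of a graph is an ordering of its vertices such that each vertex has at most $k$ neighbors later in the order. A graph $G$ is nice with respect to a vertex set $S$ if (a) $S$ is a clique in $G^2$, (b) $S$ is an independent set in $G$, and (c) $G$ has a 2-degeneracy order in which all vertices of $S$ appear consecutively. *)

(* Defs.v *)
From mathcomp Require Import all_boot.
Set Implicit Arguments. Unset Strict Implicit. Unset Printing Implicit Defensive.

(* A finite simple graph: vertex type T : finType, edge relation e : rel T,
   required (in the theorem) to be symmetric and irreflexive. *)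

Definition sq_adj (T : finType) (e : rel T) : rel T :=
  fun x y => (x != y) && (e x y || [exists z, e x z && e z y]).

Definition is_clique (T : finType) (r : rel T) (S : {set T}) : bool :=
  [forall x in S, forall y in S, (x != y) ==> r x y].

Definition is_indep (T : finType) (r : rel T) (S : {set T}) : bool :=
  [forall x in S, forall y in S, ~~ r x y].

Definition clique_number (T : finType) (r : rel T) : nat :=
  \max_(A : {set T} | is_clique r A) #|A|.

Definition is_max_clique (T : finType) (r : rel T) (S : {set T}) : bool :=
  is_clique r S && (#|S| == clique_number r).

Definition max_deg_le (T : finType) (e : rel T) (D : nat) : Prop :=
  forall x : T, #|[set y | e x y]| <= D.

Definition vertex_order (T : finType) (s : seq T) : bool :=
  uniq s && all (fun x => x \in s) (enum T).

Definition degeneracy_order (T : finType) (e : rel T) (k : nat) (s : seq T) : bool :=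
  vertex_order s &&
  [forall x, #|[set y | e x y & index x s < index y s]| <= k].

Definition nice (T : finType) (e : rel T) (S : {set T}) : Prop :=
  [/\ is_clique (sq_adj e) S,
      is_indep e S &
      exists s1 s2 s3 : seq T,
        degeneracy_order e 2 (s1 ++ s2 ++ s3) /\ [set x in s2] = S].

(* Main.v *)
Require Import Defs.
From mathcomp Require Import all_boot.
From mathcomp Require Import zify.
Set Implicit Arguments. Unset Strict Implicit. Unset Printing Implicit Defensive.

(** Write the order as [s1 ++ S ++ s3].  If some vertex of [S] has at most one
    neighbour in [s3], a direct count bounds [#|S|].  Otherwise each vertex of
    [S] is an edge of a multigraph on [s3], joining its two later neighbours.
    This multigraph has maximum degree at most [D].  Two disjoint edges have a
    common neighbour in [s1], which serves no other pair as it has at most two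
    later neighbours; hence every edge is disjoint from at most [D] others.

    In such a multigraph with [n] edges, [n <= D + d u + d v - m u v] whenever
    [u] and [v] are adjacent, with [m] the multiplicity.  Summing this over the
    neighbours of a vertex of minimum positive degree contradicts [5 D < 2 n]. *)

(* [p] vertices; [u] of minimum degree [d] has [h] neighbours, whose degrees
   sum to [s]. *)
Lemma min_degree_arith (n D p h d s : nat) :
  5 * D < 2 * n -> 2 * n <= p * D -> 0 < h -> h < p ->
  h * n + d <= h * D + h * d + s -> s <= h * D ->
  s + (p - h) * d <= 2 * n -> p * d <= 2 * n -> False.
Proof.
move=> nD npD h0 hp hn sD sd pd.
(* Bound [s] by [h * D] and divide by [h]. *)
have nd : n <= 2 * D + d by nia.
have p5 : 5 < p by nia.
(* If [10 <= p] then [5 * d <= n], and [nd] yields [2 * n <= 5 * D]. *)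
have p9 : p < 10.
  rewrite ltnNge; apply/negP => p10.
  have : 10 * d <= p * d by rewrite leq_mul2r p10 orbT.
  lia.
(* Once [p] and [h] are numerals, every hypothesis is linear. *)
have hE : h = 1 \/ h = 2 \/ h = 3 \/ h = 4 \/ h = 5 \/ h = 6 \/ h = 7 \/ h = 8.
  by lia.
have pE : p = 6 \/ p = 7 \/ p = 8 \/ p = 9 by lia.
by case: pE hE => [|[|[|]]] ? [|[|[|[|[|[|[|]]]]]]] ?; subst p h; lia.
Qed.

Section Multigraph.
Variables (E V : finType) (S : {set E}) (ends : E -> {set V}) (D : nat).

Let inc (a : V) : {set E} := [set x in S | a \in ends x].

Lemma sum_card_inc (P : {set V}) (B : {set E}) :
  \sum_(a in P) #|[set x in B | a \in ends x]| =
  \sum_(x in B) #|ends x :&: P|.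
Proof.
under eq_bigr => a _ do rewrite -sum1dep_card big_mkcondr /=.
rewrite exchange_big /=; apply: eq_bigr => x _.
rewrite -big_mkcondr sum1dep_card; apply: eq_card => a.
by rewrite !inE andbC.
Qed.

Hypothesis ends2 : forall x, x \in S -> #|ends x| = 2.
Hypothesis degD : forall a, #|inc a| <= D.
Hypothesis disjD :
  forall x, x \in S -> #|[set y in S | [disjoint ends x & ends y]]| <= D.

(** Take an edge [x] joining [u] and [b]: every edge is disjoint from [x] or meets [u] or [b], and
    inclusion-exclusion removes the parallel edges counted twice. *)
Lemma adjacent_degrees (u b : V) :
  b != u -> inc u :&: inc b != set0 ->
  #|S| + #|inc u :&: inc b| <= D + #|inc u| + #|inc b|.
Proof.
move=> bu /set0Pn[x]; rewrite !inE => /andP[/andP[xS ux] /andP[_ bx]].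
have ex : ends x = [set u; b].
  apply/esym/eqP; rewrite eqEcard ends2 // cards2 eq_sym bu andbT.
  by apply/subsetP => c; rewrite !inE => /orP[] /eqP->.
have sub : S \subset [set y in S | [disjoint ends x & ends y]]
                     :|: (inc u :|: inc b).
  apply/subsetP => y yS; rewrite !inE yS /= ex disjoints_subset subUset !sub1set.
  by rewrite !inE; do 2 case: (_ \in ends y).
have := leq_trans (subset_leq_card sub) (leq_card_setU _ _).
have := cardsUI (inc u) (inc b); have := disjD xS; lia.
Qed.

Lemma multigraph_edges : 2 * #|S| <= 5 * D.
Proof.
rewrite leqNgt; apply/negP => nD.
(* Isolated vertices are dropped so that the vertex of minimum degree has a neighbour. *)
pose P := [set a | 0 < #|inc a|].
have incP a x : x \in S -> a \in ends x -> a \in P.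
  by move=> xS ax; rewrite inE; apply/card_gt0P; exists x; rewrite inE xS.
have sumP : \sum_(a in P) #|inc a| = 2 * #|S|.
  rewrite sum_card_inc mulnC -sum_nat_const; apply: eq_bigr => x xS.
  rewrite -(ends2 xS); congr #|pred_of_set _|; apply/setIidPl/subsetP => a.
  exact: incP.
have [u0 u0P] : exists u, u \in P.
  apply/set0Pn/eqP => P0; move: sumP; rewrite P0 big_set0; lia.
case: (arg_minnP (fun a => #|inc a|) u0P) => u uP umin.
pose N := [set b | (b != u) && (inc u :&: inc b != set0)].
have NP : N \subset P.
  apply/subsetP => b; rewrite !inE => /andP[_ /set0Pn[x]].
  by rewrite !inE => /andP[_ /andP[xS bx]]; apply/card_gt0P; exists x; rewrite inE xS.
(* Each edge at [u] has exactly one other end, and it lies in [N]. *)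
have sumN : \sum_(b in N) #|inc u :&: inc b| = #|inc u|.
  rewrite -[RHS]sum1_card.
  transitivity (\sum_(b in N) #|[set x in inc u | b \in ends x]|).
    apply: eq_bigr => b _; apply: eq_card => x; rewrite !inE.
    by case: (x \in S); rewrite ?andbF.
  rewrite sum_card_inc; apply: eq_bigr => x; rewrite inE => /andP[xS ux].
  have -> : ends x :&: N = ends x :\ u.
    apply/setP => b; rewrite !inE andbC; case: eqP => //= _.
    case bx: (b \in ends x); rewrite ?andbF // andbT.
    by apply/set0Pn; exists x; rewrite !inE xS ux.
  by have := cardsD1 u (ends x); rewrite ends2 // ux; case.
have sumle (Q : {set V}) : Q \subset P -> #|Q| * #|inc u| <= \sum_(a in Q) #|inc a|.
  move=> QP; rewrite -sum_nat_const; apply: leq_sum => a aQ.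
  exact/umin/(subsetP QP).
have sumge (Q : {set V}) : \sum_(a in Q) #|inc a| <= #|Q| * D.
  by rewrite -sum_nat_const; apply: leq_sum.
apply: (@min_degree_arith #|S| D #|P| #|N| #|inc u| (\sum_(b in N) #|inc b|)) => //.
- by rewrite -sumP.
- rewrite card_gt0; apply/eqP => N0; move: sumN (uP : u \in P).
  by rewrite N0 big_set0 inE => <-.
- apply: proper_card; apply/properP; split=> //.
  by exists u => //; rewrite inE eqxx.
- rewrite -[in X in X <= _]sumN -!sum_nat_const -!big_split /=.
  by apply: leq_sum => b; rewrite inE => /andP[bu ub]; exact: adjacent_degrees.
(* Split the degree sum over [P] at [N]; each vertex outside [N] contributes at least the minimum
   degree. *)
- rewrite -sumP [leqRHS](big_setID N) /= (setIidPr NP) leq_add2l.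
  by rewrite -(cardsDS NP) sumle // subsetDl.
- by rewrite -sumP sumle.
Qed.

End Multigraph.

Lemma index_block (T : eqType) (s1 s2 s3 : seq T) (x y z : T) :
  uniq (s1 ++ s2 ++ s3) -> x \in s2 -> y \in s2 -> z \notin s2 ->
  index x (s1 ++ s2 ++ s3) < index z (s1 ++ s2 ++ s3) ->
  index y (s1 ++ s2 ++ s3) < index z (s1 ++ s2 ++ s3).
Proof.
rewrite cat_uniq => /and3P[_ /hasPn d1 _] xs ys zs.
have ns1 w : w \in s2 -> (w \in s1) = false.
  by move=> ws; apply/negbTE/d1; rewrite mem_cat ws.
rewrite !index_cat (ns1 _ xs) (ns1 _ ys) xs ys (negbTE zs).
case: ifP => [zs1|_ _]; first by rewrite -index_mem in zs1; lia.
by rewrite ltn_add2l ltn_addr // index_mem.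
Qed.

Section Nice.
Variables (T : finType) (e : rel T) (D : nat).
Hypotheses (e_sym : symmetric e) (degD : max_deg_le e D).
Variables (s1 s2 s3 : seq T).
Let s := s1 ++ s2 ++ s3.
Let S := [set x in s2].
Hypotheses (S_clique : is_clique (sq_adj e) S) (S_indep : is_indep e S).
Hypothesis s_deg : degeneracy_order e 2 s.

Let later (x : T) : {set T} := [set y | e x y & index x s < index y s].

Lemma card_later x : #|later x| <= 2.
Proof. by case/andP: s_deg => _ /forallP/(_ x). Qed.

Lemma indepS x y : x \in S -> y \in S -> e x y = false.
Proof.
by move=> xS yS; apply/negbTE; move/forallP/(_ x)/implyP/(_ xS): S_indep
  => /forallP/(_ y)/implyP/(_ yS).
Qed.

(** Independence puts the common neighbour [z] outside the block [s2], so it comes after all of the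
    block or after none of it. *)
Lemma later_block x y z :
  x \in S -> y \in S -> e x z -> e z y -> z \in later x -> z \in later y.
Proof.
move=> xS yS xz zy; rewrite !inE (e_sym y) zy xz /=.
have zS : z \notin s2.
  by apply/negP => zs; move: xz; rewrite indepS // inE.
case/andP: s_deg => /andP[us _] _; move: xS yS; rewrite !inE => xS yS.
exact: index_block.
Qed.

Lemma later_flip x z : e x z -> x \in S -> z \notin later x -> x \in later z.
Proof.
move=> xz xS; rewrite !inE xz (e_sym z) xz /= -leqNgt leq_eqVlt => /orP[/eqP exz|//].
have ms w : w \in s.
  case/andP: s_deg => /andP[_ /allP al] _.
  by apply: al; rewrite mem_enum.
have zx : z = x by exact: index_inj (ms z) (ms x) exz.
by move: xz; rewrite zx indepS.
Qed.

Lemma card_disjoint x : x \in S ->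
  #|[set y in S | (y != x) && [disjoint later x & later y]]| <= D.
Proof.
move=> xS; set B := [set y in S | _].
(* A chosen common neighbour; the default [x] is never reached for [y] in [B]. *)
pose c y := odflt x [pick z | e x z && e z y].
have cP y : y \in B -> [/\ e x (c y), x \in later (c y) & y \in later (c y)].
  rewrite inE => /and3P[yS yx dis].
  have /andP[_] : sq_adj e x y.
    move/forallP/(_ x)/implyP/(_ xS): S_clique => /forallP/(_ y)/implyP/(_ yS).
    by rewrite eq_sym yx.
  rewrite indepS //= => /existsP[w wP]; rewrite /c.
  case: pickP => [z /andP[xz zy] /=|/(_ w)]; last by rewrite wP.
  have yz : e y z by rewrite e_sym.
  have zx : e z x by rewrite e_sym.
  have nx : z \notin later x.
    apply/negP => zlx; have zly := later_block xS yS xz zy zlx.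
    by move: dis; rewrite disjoints_subset => /subsetP/(_ z zlx); rewrite inE zly.
  have ny : z \notin later y.
    by apply: contra nx; apply: later_block.
  by split => //; apply: later_flip.
rewrite -(@card_in_imset _ _ c).
  apply: leq_trans (degD x); apply: subset_leq_card; apply/subsetP => z.
  by case/imsetP => y /cP[xc _ _] ->; rewrite inE.
(* Were [c] not injective, [c y] would have three later neighbours [x], [y], [y']. *)
move=> y y' yB y'B cE; apply/eqP; apply: contraT => yy'.
have [_ l1 l2] := cP y yB; have [_ _ l3] := cP y' y'B; rewrite -cE in l3.
have yx : y != x by move: yB; rewrite inE => /and3P[].
have y'x : y' != x by move: y'B; rewrite inE => /and3P[].
have : #|x |: [set y; y']| <= #|later (c y)|.
  by apply: subset_leq_card; rewrite !subUset !sub1set l1 l2 l3.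
rewrite cardsU1 cards2 !inE yy' negb_or eq_sym yx eq_sym y'x /=.
by move=> h; have := leq_trans h (card_later _).
Qed.

Lemma nice_bound : 0 < D -> 2 * #|S| <= 5 * D.
Proof.
move=> D0; have [|/forall_inPn[x xS]] :=
  boolP [forall x in S, #|later x| == 2]; last first.
  move=> l2; have {l2} : #|later x| < 2 by rewrite ltn_neqAle l2 card_later.
  (* A vertex whose later set meets that of [x] is adjacent to the at most one later neighbour of
     [x]. *)
  have cover : S \subset [set y in S | (y != x) && [disjoint later x & later y]]
      :|: (x |: \bigcup_(a in later x) [set y | e a y]).
    apply/subsetP => y yS; rewrite !inE; have [//|yx] := eqVneq y x.
      by rewrite orbT.
    rewrite inE in yS; rewrite yS /=.
    case dis: [disjoint _ & _] => //=; move/negbT: dis.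
    rewrite -setI_eq0 => /set0Pn[a]; rewrite inE => /andP[ax ay].
    apply/bigcupP; exists a => //.
    by move: ay; rewrite !inE e_sym => /andP[].
  have cS := leq_trans (subset_leq_card cover) (leq_card_setU _ _).
  have {}cS := leq_trans cS (leq_add (card_disjoint xS) (leqnn _)).
  case E: #|later x| => [|[|//]] _.
    move: E cS => /eqP; rewrite cards_eq0 => /eqP ->.
    rewrite big_set0 setU0 cards1; lia.
  move/eqP: E => /cards1P[a la]; move: cS; rewrite la big_set1.
  (* Since [x] is itself a neighbour of [a], the total is at most [2 * D] with no extra one. *)
  have -> : x |: [set y | e a y] = [set y | e a y].
    apply/setUidPr; rewrite sub1set inE e_sym.
    by move: (set11 a); rewrite -la inE => /andP[].
  have := degD a; lia.
move=> /forall_inP l2; apply: (@multigraph_edges _ _ S later).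
- by move=> x /l2/eqP.
- move=> a; apply: leq_trans (degD a); apply/subset_leq_card/subsetP => x.
  by rewrite !inE e_sym => /and3P[].
- move=> x xS; apply: leq_trans (card_disjoint xS).
  apply/subset_leq_card/subsetP => y; rewrite !inE => /andP[-> dis].
  (* A two-element set is not disjoint from itself, so [y] differs from [x]. *)
  rewrite dis andbT /=; apply/eqP => yx; move: dis.
  by rewrite yx -setI_eq0 setIid -cards_eq0 (eqP (l2 x xS)).
Qed.

End Nice.

Theorem theorem3 (T : finType) (e : rel T) (D : nat) :
  symmetric e -> irreflexive e -> 0 < D -> max_deg_le e D ->
  (exists S : {set T}, is_max_clique (sq_adj e) S /\ nice e S) ->
  2 * clique_number (sq_adj e) <= 5 * D.
Proof.
move=> e_sym _ D0 degD [S [/andP[_ /eqP <-] [cl ind [s1 [s2 [s3 [ord SE]]]]]]].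
rewrite -SE in cl ind *; exact: nice_bound ord D0.
Qed.
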